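(* Let $\mathcal{A}=\{A_1,\dots,A_m\}$ be a set of $m$ matrices in $\mathbb{R}^{n\times n}$ with joint spectral radius $\rho(\mathcal{A})$. Let $\hat\rho_{\mathcal{V}^2,G_1}(\mathcal{A})$ be the bound on the joint spectral radius obtained from the linear matrix inequalities $$P_i\succ0\quad\forall i=1,\dots,m,\qquad \gamma^2A_i^TP_jA_i\preceq P_i\quad\forall (i,j)\in\{1,\dots,m\}^2.$$ Then $$\frac{1}{\sqrt[4]{n}}\,\hat\rho_{\mathcal{V}^2,G_1}(\mathcal{A})\le\rho(\mathcal{A})\le\hat\rho_{\mathcal{V}^2,G_1}(\mathcal{A}).$$
   Context: The joint spectral radius is $\rho(\mathcal{A})=\lim_{k\to\infty}\max_{\sigma\in\{1,\dots,m\}^k}\|A_{\sigma_k}\cdots A_{\sigma_1}\|^{1/k}$ (independent of the norm). The bound $\hat\rho_{\mathcal{V}^2,G_1}(\mathcal{A})$ is the reciprocal of the largest $\gamma>0$ for which the stated linear matrix inequalities are feasible in symmetric $n\times n$ matrices $P_1,\dots,P_m$; precisely, the infimum of $1/\gamma$ over all $\gamma>0$ for which they are feasible. $\succ$ and $\preceq$ denote the positive definite and positive semidefinite orders on symmetric matrices. *)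

(* Defs.v *)
From HB Require Import structures.
From mathcomp Require Import all_boot all_order all_algebra.
From mathcomp Require Import all_classical all_reals all_analysis.

Set Implicit Arguments.
Unset Strict Implicit.
Unset Printing Implicit Defensive.

Import Order.TTheory GRing.Theory Num.Theory.
Import numFieldNormedType.Exports.
Local Open Scope classical_set_scope.
Local Open Scope ring_scope.

(* A_{sigma_k} ... A_{sigma_1}: [rev_ord] makes the first letter of the word
   the rightmost factor. *)
Definition word_product (R : realType) (n m k : nat) (A : 'I_m -> 'M[R]_n)
    (sigma : k.-tuple 'I_m) : 'M[R]_n :=
  \prod_(i < k) A (tnth sigma (rev_ord i)).

(* [`|_|] is the entrywise maximum norm on matrices; the limit is the same for
   every norm.  The base value 0 of the maximum is harmless for 0 < m, as all
   the terms are nonnegative. *)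
Definition joint_spectral_radius (R : realType) (n m : nat)
    (A : 'I_m -> 'M[R]_n) : R :=
  limn (fun k : nat =>
    \big[Num.max/0]_(sigma : k.-tuple 'I_m)
      (`|word_product A sigma| `^ k%:R^-1)).

Definition posdefmx (R : realType) (n : nat) (M : 'M[R]_n) : Prop :=
  M \is symmetricmx /\
  forall x : 'cV[R]_n, x != 0 -> 0 < (x^T *m M *m x) 0 0.

Definition possemidefmx (R : realType) (n : nat) (M : 'M[R]_n) : Prop :=
  M \is symmetricmx /\
  forall x : 'cV[R]_n, 0 <= (x^T *m M *m x) 0 0.

Definition loewner_le (R : realType) (n : nat) (M N : 'M[R]_n) : Prop :=
  possemidefmx (N - M).

Definition V2G1_feasible (R : realType) (n m : nat) (A : 'I_m -> 'M[R]_n)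
    (gamma : R) : Prop :=
  exists P : 'I_m -> 'M[R]_n,
    (forall i, posdefmx (P i)) /\
    (forall i j,
       loewner_le (gamma ^+ 2 *: ((A i)^T *m P j *m A i)) (P i)).

(* The set is nonempty (small gamma, P_i = I) and bounded below by 0, so [inf]
   is a true infimum; it is 0 when every gamma is feasible. *)
Definition rhohat_V2G1 (R : realType) (n m : nat) (A : 'I_m -> 'M[R]_n) : R :=
  inf [set gamma^-1 | gamma in
        [set gamma : R | 0 < gamma /\ V2G1_feasible A gamma]].

(* Main.v *)
Require Import Defs.
From HB Require Import structures.
From mathcomp Require Import all_boot all_order all_algebra.
From mathcomp Require Import all_classical all_reals all_analysis.
From mathcomp Require Import perm ring lra.

Set Implicit Arguments.
Unset Strict Implicit.
Unset Printing Implicit Defensive.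

Import Order.TTheory GRing.Theory Num.Theory.
Import numFieldNormedType.Exports.
Local Open Scope classical_set_scope.
Local Open Scope ring_scope.

(** The key observation is that the joint spectral radius is the infimum of
    the growth rates of the family, the numbers [t] such that every product of
    [k] matrices has norm at most [C * t ^+ k] for a constant [C]
    ([jsr_growth]).  Both inequalities are then statements about growth rates.

    If [gamma] is feasible, one step [x |-> A_i x] divides the forms [P_i] by
    at least [gamma ^+ 2], so that a product of length [k] divides them by at
    least [gamma ^+ (2 * k)]; as all norms on a finite-dimensional space are
    equivalent, [gamma^-1] is a growth rate ([feasible_growth_rate]).

    Conversely, let [lam] be a growth rate.  The row functionals
    [lam ^- k * (row of a product of length k)] form a bounded set [F] that is
    mapped into [lam * F] by composition with each [A_i]: the supremum of
    [|f x|] over [F] is a norm for which every [A_i] has operator norm at most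
    [lam].  John's theorem approximates this norm by a Euclidean one within a
    factor [sqrt n], so the products of length two satisfy a common quadratic
    Lyapunov inequality for the resulting form [P], with constant
    [lam ^+ 4 * n] up to an arbitrarily small error.  Spending the loss of
    John's theorem on two steps instead of one is what turns [sqrt n] into its
    square root: the forms [P_i = P + gamma ^+ 2 * A_i^T P A_i] satisfy the
    one-step inequalities as soon as [P] satisfies the two-step one
    ([growth_rate_feasible]).

    John's theorem is proved in its dual form, as in the Kiefer-Wolfowitz
    equivalence theorem on optimal designs.  Among the positive semidefinite
    forms lying below [x |-> sup over F of (f x) ^+ 2], one whose determinant
    is nearly maximal satisfies [f P^-1 f^T <= n + d] for all [f] in [F]:
    otherwise mixing a little of [f^T f] into [P] would increase the
    determinant too much ([approx_john]).  The infimum in the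
    definition of the bound absorbs the arbitrarily small loss [d], so a near
    maximizer, provided by the definition of a supremum, does the work of an
    exact one. *)

(** * Quadratic forms *)

Definition qform (R : realType) (n : nat) (P : 'M[R]_n) (x : 'cV[R]_n) : R :=
  (x^T *m P *m x) 0 0.

Lemma entryD (R : realType) (p q : nat) (M N : 'M[R]_(p, q)) i j :
  (M + N) i j = M i j + N i j.
Proof. by rewrite mxE. Qed.

Lemma entryZ (R : realType) (p q : nat) (a : R) (M : 'M[R]_(p, q)) i j :
  (a *: M) i j = a * M i j.
Proof. by rewrite mxE. Qed.

Lemma symmetricmxP (R : realType) (n : nat) (P : 'M[R]_n) :
  (P \is symmetricmx) <-> P^T = P.
Proof.
split=> [/is_hermitianmxP|H].
  by rewrite expr0 scale1r map_mx_id.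
by apply/is_hermitianmxP; rewrite expr0 scale1r map_mx_id.
Qed.

Lemma qformD (R : realType) (n : nat) (P Q : 'M[R]_n) (x : 'cV[R]_n) :
  qform (P + Q) x = qform P x + qform Q x.
Proof. by rewrite /qform mulmxDr mulmxDl entryD. Qed.

Lemma qformZ (R : realType) (n : nat) (a : R) (P : 'M[R]_n) (x : 'cV[R]_n) :
  qform (a *: P) x = a * qform P x.
Proof. by rewrite /qform -scalemxAr -scalemxAl entryZ. Qed.

Lemma qform_congr (R : realType) (n : nat) (P B : 'M[R]_n) (x : 'cV[R]_n) :
  qform (B^T *m P *m B) x = qform P (B *m x).
Proof. by rewrite /qform trmx_mul !mulmxA. Qed.

Lemma qform_rank1 (R : realType) (n : nat) (f : 'rV[R]_n) (x : 'cV[R]_n) :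
  qform (f^T *m f) x = ((f *m x) 0 0) ^+ 2.
Proof.
rewrite /qform mulmxA -trmx_mul -mulmxA [LHS]mxE big_ord1 mxE expr2.
by congr (_ * _); rewrite ord1.
Qed.

Lemma qform1 (R : realType) (n : nat) (x : 'cV[R]_n) :
  qform 1%:M x = \sum_i (x i 0) ^+ 2.
Proof.
rewrite /qform mulmx1 mxE; apply: eq_bigr => i _.
by rewrite mxE expr2.
Qed.

Lemma qform_delta (R : realType) (n : nat) (P : 'M[R]_n) (i : 'I_n) :
  qform P (delta_mx i 0) = P i i.
Proof. by rewrite /qform trmx_delta -rowE -colE !mxE. Qed.

Lemma discriminant_le0 (R : realType) (a b c : R) :
  0 <= c -> (forall t, 0 <= a + t * b *+ 2 + t ^+ 2 * c) -> b ^+ 2 <= a * c.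
Proof.
rewrite le_eqVlt => /predU1P[<- h|c0 h].
  have [->|b0] := eqVneq b 0; first by rewrite expr2 !mulr0.
  have := h (- (a + 1) / (b *+ 2)).
  rewrite mulr0 addr0.
  have -> : - (a + 1) / (b *+ 2) * b *+ 2 = - (a + 1) by field.
  by lra.
have := h (- b / c).
have -> : a + - b / c * b *+ 2 + (- b / c) ^+ 2 * c = (a * c - b ^+ 2) / c.
  by field; rewrite gt_eqF.
by rewrite pmulr_lge0 ?invr_gt0// subr_ge0.
Qed.

(** Cauchy-Schwarz for the semi-inner product of [P], applied to [x] and to
    [invmx P *m f^T], the vector that represents [f]. *)
Lemma dual_bound (R : realType) (n : nat) (P : 'M[R]_n) (f : 'rV[R]_n)
    (x : 'cV[R]_n) :
  possemidefmx P -> P \in unitmx ->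
  ((f *m x) 0 0) ^+ 2 <= (f *m invmx P *m f^T) 0 0 * qform P x.
Proof.
move=> [/symmetricmxP symP psdP] uP.
pose y := invmx P *m f^T.
have Py : P *m y = f^T by rewrite mulmxA mulmxV// mul1mx.
have yP : y^T *m P = f by rewrite -[f in RHS]trmxK -Py [RHS]trmx_mul symP.
have fx : (x^T *m f^T) 0 0 = (f *m x) 0 0 by rewrite -trmx_mul mxE.
have fy : (f *m y) 0 0 = (f *m invmx P *m f^T) 0 0 by rewrite mulmxA.
rewrite -fy; apply: discriminant_le0; first exact: psdP.
move=> t; have := psdP (y + t *: x); congr (0 <= _).
have -> : (y + t *: x)^T = y^T + t *: x^T by rewrite linearD/= linearZ.
rewrite !mulmxDl yP !mulmxDr -!scalemxAl -!scalemxAr -(mulmxA x^T P y) Py.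
by rewrite /qform !entryD !entryZ fx; ring.
Qed.

Lemma posdef_possemidef (R : realType) (n : nat) (P : 'M[R]_n) :
  posdefmx P -> possemidefmx P.
Proof.
move=> [sP pP]; split=> // x; have [->|/pP/ltW//] := eqVneq x 0.
by rewrite mulmx0 mxE.
Qed.

Lemma posdef_unit (R : realType) (n : nat) (P : 'M[R]_n) :
  posdefmx P -> P \in unitmx.
Proof.
move=> [_ pP]; rewrite -row_free_unit -kermx_eq0; apply/negPn/negP => kP.
have vP : nz_row (kermx P) *m P = 0 by apply/sub_kermxP; exact: nz_row_sub.
have := pP (nz_row (kermx P))^T.
by rewrite trmxK vP mul0mx mxE ltxx trmx_eq0 nz_row_eq0 => /(_ kP).
Qed.

Lemma dual_form_ge0 (R : realType) (n : nat) (P : 'M[R]_n) (f : 'rV[R]_n) :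
  possemidefmx P -> P \in unitmx -> 0 <= (f *m invmx P *m f^T) 0 0.
Proof.
move=> [/symmetricmxP sP pP] uP; have := pP (invmx P *m f^T).
by rewrite trmx_mul trmxK trmx_inv sP mulmxKV// mulmxA.
Qed.

Lemma loewner_leE (R : realType) (n : nat) (M N : 'M[R]_n) :
  M \is symmetricmx -> N \is symmetricmx ->
  loewner_le M N <-> forall x, qform M x <= qform N x.
Proof.
move=> /symmetricmxP sM /symmetricmxP sN.
have E x : qform (N - M) x = qform N x - qform M x.
  by rewrite -scaleN1r qformD qformZ mulN1r.
split=> [[_ h] x|h]; first by rewrite -subr_ge0 -E; apply: h.
split=> [|x]; first by apply/symmetricmxP; rewrite linearB/= sM sN.
by rewrite -/(qform _ x) E subr_ge0.
Qed.

Lemma sym_congr (R : realType) (n : nat) (a : R) (P B : 'M[R]_n) :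
  P \is symmetricmx -> a *: (B^T *m P *m B) \is symmetricmx.
Proof.
move=> /symmetricmxP sP; apply/symmetricmxP.
by rewrite linearZ/= !trmx_mul trmxK sP mulmxA.
Qed.

(** * An approximate John theorem *)

(** The second clause says that [qform P x] is at most the supremum of the
    squares [(f x) ^+ 2] over [F]; quantifying over the upper bounds [c] of
    these squares spares a discussion of when the supremum exists. *)
Definition dominated (R : realType) (n : nat) (F : set 'rV[R]_n) (P : 'M[R]_n)
    : Prop :=
  possemidefmx P /\
  forall x c, (forall f, F f -> ((f *m x) 0 0) ^+ 2 <= c) -> qform P x <= c.

Lemma dominated_rank1 (R : realType) (n : nat) (F : set 'rV[R]_n)
    (f : 'rV[R]_n) : F f -> dominated F (f^T *m f).
Proof.
move=> Ff; split=> [|x c]; last by rewrite qform_rank1; apply.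
split=> [|x]; first by apply/symmetricmxP; rewrite trmx_mul trmxK.
by rewrite -/(qform _ x) qform_rank1 sqr_ge0.
Qed.

Lemma dominated_convex (R : realType) (n : nat) (F : set 'rV[R]_n)
    (P Q : 'M[R]_n) (a : R) :
  0 <= a <= 1 -> dominated F P -> dominated F Q ->
  dominated F ((1 - a) *: P + a *: Q).
Proof.
move=> /andP[a0 a1] [[/symmetricmxP sP pP] lP] [[/symmetricmxP sQ pQ] lQ].
have a1' : 0 <= 1 - a by rewrite subr_ge0.
split=> [|x c h].
  split=> [|x].
    by apply/symmetricmxP; rewrite linearD/= !linearZ/= sP sQ.
  rewrite -/(qform _ x) qformD !qformZ addr_ge0// mulr_ge0//.
    exact: pP.
  exact: pQ.
rewrite qformD !qformZ.
have -> : c = (1 - a) * c + a * c by ring.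
by rewrite lerD// ler_wpM2l//; [apply: lP|apply: lQ].
Qed.

(** The diagonal entries are values of the form on basis vectors; a positive
    semidefinite matrix has no entry larger than its largest diagonal one. *)
Lemma dominated_entry (R : realType) (n : nat) (F : set 'rV[R]_n)
    (P : 'M[R]_n) (B : R) :
  (forall f i, F f -> `|f 0 i| <= B) -> dominated F P ->
  forall i j, `|P i j| <= B ^+ 2.
Proof.
move=> bF [[/symmetricmxP sP pP] lP] i j.
have diag k : P k k <= B ^+ 2.
  rewrite -qform_delta; apply: lP => f Ff.
  have fB := bF f k Ff; have B0 : 0 <= B := le_trans (normr_ge0 _) fB.
  by rewrite -colE mxE -real_normK ?num_real// ler_sqr ?nnegrE.
(* The form is nonnegative at [e_i + e_j] and at [e_i - e_j]. *)
have pm (s : R) : s ^+ 2 = 1 -> 0 <= P i i + P j j + s * P i j *+ 2.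
  move=> s1; have := pP (delta_mx i 0 + s *: delta_mx j 0).
  have -> : (delta_mx i 0 + s *: delta_mx j 0)^T =
     delta_mx 0 i + s *: delta_mx 0 j :> 'rV[R]_n.
    by rewrite linearD/= linearZ/= !trmx_delta.
  rewrite !mulmxDl !mulmxDr -!scalemxAl -!scalemxAr -!rowE -!colE.
  rewrite !entryD !entryZ !mxE.
  have -> : P j i = P i j by rewrite -[in RHS]sP mxE.
  rewrite [s * (s * _)]mulrA -expr2 s1 mul1r; congr (0 <= _); ring.
have := pm 1 (expr1n _ _); have := pm (-1) (sqrr_sign _ 1%N).
rewrite ler_norml; have := diag i; have := diag j; lra.
Qed.

Lemma det_le_entry (R : realType) (n : nat) (P : 'M[R]_n) (B : R) :
  (forall i j, `|P i j| <= B) -> \det P <= (n`!)%:R * B ^+ n.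
Proof.
move=> bP; apply: le_trans (ler_norm _) _.
apply: le_trans (ler_norm_sum _ _ _) _.
rewrite -card_Sn -sum1_card natr_sum mulr_suml; apply: ler_sum => s _.
rewrite normrM normrX normrN1 expr1n !mul1r normr_prod.
rewrite -[n in B ^+ n]card_ord -prodr_const; apply: ler_prod => i _.
by rewrite normr_ge0 bP.
Qed.

Lemma bernoulli_ge (R : realType) (a : R) (k : nat) :
  0 <= a <= 1 -> 1 - k%:R * a <= (1 - a) ^+ k.
Proof.
move=> /andP[a0 a1]; elim: k => [|k ih]; first by rewrite mul0r subr0 expr0.
rewrite exprSr; apply: (@le_trans _ _ ((1 - k%:R * a) * (1 - a))).
  rewrite -natr1; have : 0 <= k%:R * a * a by rewrite !mulr_ge0.
  by lra.
by rewrite ler_wpM2r// subr_ge0.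
Qed.

(** The function [(1 - a) ^+ k * (1 - a + a * s)] of [a] has value [1] and
    derivative [s - k.+1] at [0].  A single weight [a] gives a gain that is
    uniform in [s >= k.+1 + d]. *)
Lemma mixing_weight (R : realType) (k : nat) (d : R) : 0 < d ->
  exists a e : R, [/\ 0 < a < 1, 0 < e & forall s, k.+1%:R + d <= s ->
    1 + e <= (1 - a) ^+ k * (1 - a + a * s)].
Proof.
move=> d0; pose N : R := k%:R.
have N0 : 0 <= N by apply: ler0n.
(* [a] is small enough for the quadratic term of the gain to use up at most
   half of the linear term [a * d]. *)
pose D := 2 * (N + 1) * (N + 1 + d).
have D0 : 0 < D by rewrite !mulr_gt0//; lra.
pose a := d / D.
have a0 : 0 < a by rewrite divr_gt0.
have aD : a * D = d by rewrite divfK// gt_eqF.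
have Nd0 : 0 <= N * d by rewrite mulr_ge0// ltW.
have NN0 : 0 <= N * N by rewrite mulr_ge0.
have DE : D = 2 * (N * N) + 4 * N + 2 + 2 * (N * d) + 2 * d by rewrite /D; ring.
have dD : N * d <= D / 2 by lra.
have Na : N * a <= 1 / 2 by rewrite /a mulrA ler_pdivrMr//; lra.
have a1 : a < 1 by rewrite ltr_pdivrMr// mul1r; lra.
have ad0 : 0 < a * d by apply: mulr_gt0.
exists a, (a * d / 2); split; [by rewrite a0|lra|].
move=> s hs.
have ha : 0 <= a <= 1 by rewrite !ltW.
have hN : 1 - N * a <= (1 - a) ^+ k by exact: bernoulli_ge.
have hs' : 1 + a * (N + d) <= 1 - a + a * s.
  by move: hs; rewrite -natr1 -/N => hs; nra.
apply: (@le_trans _ _ ((1 - N * a) * (1 + a * (N + d)))); last first.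
  by apply: ler_pM => //; nra.
have -> : (1 - N * a) * (1 + a * (N + d)) = 1 + a * d - a * (a * (N * (N + d))).
  by ring.
have h : a * (N * (N + d)) <= d / 2.
  rewrite -[in leRHS]aD -mulrA ler_pM2l// mulrDr; lra.
by have := ler_wpM2l (ltW a0) h; lra.
Qed.

(** The matrix [block_mx 1 (- v) u 1] has two block-triangular factorizations,
    with the two sides as determinants. *)
Lemma det_add_rank1 (R : comNzRingType) (n : nat) (u : 'cV[R]_n)
    (v : 'rV[R]_n) :
  \det (1%:M + u *m v) = 1 + (v *m u) 0 0.
Proof.
have e1 : block_mx 1%:M (- v) u 1%:M =
    block_mx 1%:M 0 u 1%:M *m block_mx 1%:M (- v) 0 (1%:M + u *m v).
  rewrite mulmx_block !(mul1mx, mulmx1, mul0mx, mulmx0, addr0, add0r).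
  by rewrite mulmxN addrCA addNr addr0.
have e2 : block_mx 1%:M (- v) u 1%:M =
    block_mx 1%:M (- v) 0 1%:M *m block_mx (1%:M + v *m u) 0 u 1%:M.
  rewrite mulmx_block !(mul1mx, mulmx1, mul0mx, mulmx0, addr0, add0r).
  by rewrite mulNmx addrK.
have := congr1 determinant (etrans (esym e1) e2).
rewrite !det_mulmx !det_ublock !det_lblock !det1 !mul1r mulr1 => ->.
by rewrite det_mx11 !mxE.
Qed.

Lemma det_mix_rank1 (R : realType) (n : nat) (P : 'M[R]_n.+1) (f : 'rV[R]_n.+1)
    (a : R) : P \in unitmx -> a < 1 ->
  \det ((1 - a) *: P + a *: (f^T *m f)) =
  (1 - a) ^+ n * (1 - a + a * (f *m invmx P *m f^T) 0 0) * \det P.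
Proof.
move=> uP a1; have b0 : 1 - a != 0 by rewrite gt_eqF// subr_gt0.
have -> : (1 - a) *: P + a *: (f^T *m f) =
    (1 - a) *: (P *m (1%:M + (a / (1 - a)) *: (invmx P *m f^T) *m f)).
  rewrite mulmxDr mulmx1 -scalemxAl -scalemxAr !mulmxA mulmxV// mul1mx.
  by rewrite scalerDr scalerA mulrC divfK.
rewrite detZ det_mulmx det_add_rank1 -scalemxAr entryZ mulmxA exprS.
by field.
Qed.

(** By [dual_bound], the last clause gives
    [(f x) ^+ 2 <= (n + d) * qform P x] on [F], so that [qform P] is the square
    of the norm defined by [F] up to the factor [n + d].  [P] is a dominated
    form of nearly maximal determinant: if [f] violated the last clause, then
    [(1 - a) *: P + a *: (f^T *m f)] would be dominated too, with a
    determinant above the supremum. *)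
Lemma approx_john (R : realType) (n : nat) (F : set 'rV[R]_n) (B d : R) :
  (0 < n)%N -> 0 < d ->
  (forall i, F (delta_mx 0 i)) -> (forall f i, F f -> `|f 0 i| <= B) ->
  exists P, [/\ dominated F P, P \in unitmx &
    forall f, F f -> (f *m invmx P *m f^T) 0 0 <= n%:R + d].
Proof.
case: n F => // n F _ d0 eF bF.
pose S := [set \det P | P in dominated F].
(* The mean of the squared coordinates is below their maximum, so a multiple
   of the identity is dominated. *)
pose P0 : 'M[R]_n.+1 := (n.+1%:R^-1)%:M.
have P0F : dominated F P0.
  have q0 x : qform P0 x = n.+1%:R^-1 * \sum_i (x i 0) ^+ 2.
    by rewrite /P0 -scalemx1 qformZ qform1.
  split=> [|x c h]; first split=> [|x].
  - by apply/symmetricmxP; rewrite tr_scalar_mx.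
  - rewrite -/(qform _ x) q0 mulr_ge0 ?invr_ge0// sumr_ge0// => i _.
    exact: sqr_ge0.
  rewrite q0 mulrC ler_pdivrMr// mulr_natr.
  rewrite -[n.+1 in leRHS]card_ord -sumr_const; apply: ler_sum => i _.
  by have := h _ (eF i); rewrite -rowE mxE.
have detP0 : 0 < \det P0 by rewrite det_scalar exprn_gt0// invr_gt0.
have supS : has_sup S.
  split; first by exists (\det P0), P0.
  exists (n.+1`!%:R * (B ^+ 2) ^+ n.+1) => _ [P PF <-].
  by apply: det_le_entry; apply: dominated_entry PF.
have D0 : 0 < sup S.
  by apply: lt_le_trans detP0 _; apply: ub_le_sup => //; [case: supS|exists P0].
have [a [e [/andP[a0 a1] e0 gain]]] := mixing_weight n d0.
have e1 : 0 < 1 + e by lra.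
have gap : 0 < sup S - sup S / (1 + e).
  by rewrite subr_gt0 ltr_pdivrMr//; nra.
have [_ [P PF <-]] := sup_adherent gap supS.
rewrite subKr ltr_pdivrMr// => nearP.
have detP : 0 < \det P.
  by rewrite -(pmulr_lgt0 _ e1) (lt_trans D0).
have uP : P \in unitmx by rewrite unitmxE unitfE gt_eqF.
exists P; split => // f Ff; rewrite leNgt; apply/negP => /ltW /gain big.
have QF : dominated F ((1 - a) *: P + a *: (f^T *m f)).
  by apply: dominated_convex (dominated_rank1 Ff); rewrite ?ltW.
have := ub_le_sup supS.2 (imageP determinant QF).
rewrite det_mix_rank1// => le_sup.
have := le_lt_trans le_sup nearP.
by rewrite mulrC ltr_pM2l// ltNge big.
Qed.

(** * Products along words and the growth rates *)

(** Products along words of arbitrary length, so that concatenation of words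
    is available without dependent types. *)
Definition wordmx (R : realType) (n m : nat) (A : 'I_m -> 'M[R]_n)
    (s : seq 'I_m) : 'M[R]_n := \prod_(i <- rev s) A i.

Lemma wordmx_cat (R : realType) (n m : nat) (A : 'I_m -> 'M[R]_n) s1 s2 :
  wordmx A (s1 ++ s2) = wordmx A s2 *m wordmx A s1.
Proof. by rewrite /wordmx rev_cat big_cat. Qed.

Lemma wordmx1 (R : realType) (n m : nat) (A : 'I_m -> 'M[R]_n) i :
  wordmx A [:: i] = A i.
Proof. by rewrite /wordmx big_seq1. Qed.

Lemma wordmx_cons (R : realType) (n m : nat) (A : 'I_m -> 'M[R]_n) i s :
  wordmx A (i :: s) = wordmx A s *m A i.
Proof. by rewrite -cat1s wordmx_cat wordmx1. Qed.

Lemma wordmx_nil (R : realType) (n m : nat) (A : 'I_m -> 'M[R]_n) :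
  wordmx A [::] = 1%:M.
Proof. by rewrite /wordmx big_nil. Qed.

Lemma word_productE (R : realType) (n m k : nat) (A : 'I_m -> 'M[R]_n)
    (sigma : k.-tuple 'I_m) : word_product A sigma = wordmx A sigma.
Proof.
rewrite /wordmx -[rev sigma]/(val [tuple of rev sigma]) big_tuple.
apply: eq_bigr => i _; congr (A _).
move: (tnth sigma i) => x0.
by rewrite !(tnth_nth x0) /= nth_rev ?size_tuple.
Qed.

Lemma entry_le_mxnorm (R : realType) (p q : nat) (M : 'M[R]_(p, q)) i j :
  `|M i j| <= `|M|.
Proof.
rewrite [leRHS]mx_normrE.
exact: (le_bigmax _ (fun ij : 'I_p * 'I_q => `|M ij.1 ij.2|) (i, j)).
Qed.

Lemma mxnorm_le (R : realType) (p q : nat) (M : 'M[R]_(p, q)) (c : R) :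
  0 <= c -> (forall i j, `|M i j| <= c) -> `|M| <= c.
Proof. by move=> c0 h; rewrite [leLHS]mx_normrE; apply: bigmax_le. Qed.

Lemma mxnormM (R : realType) (p q r : nat) (M : 'M[R]_(p, q))
    (N : 'M[R]_(q, r)) :
  `|M *m N| <= q%:R * (`|M| * `|N|).
Proof.
apply: mxnorm_le => [|i j]; first by rewrite !mulr_ge0.
rewrite mxE (le_trans (ler_norm_sum _ _ _))//.
have -> : q%:R * (`|M| * `|N|) = \sum_(k < q) `|M| * `|N|.
  by rewrite sumr_const card_ord mulr_natl.
by apply: ler_sum => k _; rewrite normrM ler_pM// entry_le_mxnorm.
Qed.

Lemma mxnorm1_le1 (R : realType) (n : nat) : `|1%:M : 'M[R]_n| <= 1.
Proof.
apply: mxnorm_le => // i j; rewrite mxE.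
by case: (i == j); rewrite ?normr1 ?normr0.
Qed.

Definition growth_rate (R : realType) (n m : nat) (A : 'I_m -> 'M[R]_n) (t : R)
    : Prop :=
  0 < t /\ exists2 C, 0 < C & forall s, `|wordmx A s| <= C * t ^+ size s.

Lemma growth_rate_le (R : realType) (n m : nat) (A : 'I_m -> 'M[R]_n)
    (t u : R) :
  t <= u -> growth_rate A t -> growth_rate A u.
Proof.
move=> tu [t0 [C C0 h]]; have u0 : 0 < u by apply: lt_le_trans tu.
split=> //; exists C => // s; apply: le_trans (h s) _.
by rewrite ler_pM2l// lerXn2r ?nnegrE// ?ltW.
Qed.

Lemma growth_rate_exists (R : realType) (n m : nat) (A : 'I_m -> 'M[R]_n) :
  exists t, growth_rate A t.
Proof.
pose a := \big[Num.max/0]_i `|A i|.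
have a0 : 0 <= a by apply: bigmax_ge_id.
exists (n%:R * a + 1); have t0 : 0 < n%:R * a + 1.
  by rewrite ltr_wpDl// mulr_ge0.
split=> //; exists 1 => // s; rewrite mul1r; elim: s => [|i s ih].
  by rewrite wordmx_nil expr0 mxnorm1_le1.
rewrite wordmx_cons exprSr (le_trans (mxnormM _ _))// mulrCA.
apply: ler_pM; rewrite ?mulr_ge0//.
have : `|A i| <= a by apply: (le_bigmax _ (fun i => `|A i|)).
by move=> /(ler_wpM2l (ler0n R n)) h; rewrite (le_trans h)// lerDl.
Qed.

(** The factor [n%:R] makes the maximum norm submultiplicative, so a bound on
    the products of the single length [k] propagates to all multiples of [k];
    the remaining fewer than [k] letters only affect the constant. *)
Lemma growth_rate_of_length (R : realType) (n m : nat) (A : 'I_m -> 'M[R]_n)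
    (t : R) (k : nat) :
  (0 < k)%N -> 0 < t ->
  (forall s, size s = k -> n%:R * `|wordmx A s| <= t ^+ k) -> growth_rate A t.
Proof.
move=> k0 t0 hk; split=> //.
have [u [u0 [C C0 hC]]] := growth_rate_exists A.
(* Words shorter than [k] grow at the possibly larger rate [u]; the excess
   over [t] is at most [v] per letter. *)
pose v := Num.max 1 (u / t).
have v1 : 1 <= v by rewrite le_max lexx.
have v0 : 0 < v by apply: lt_le_trans v1.
have uv : u <= v * t by rewrite -ler_pdivrMr// le_max lexx orbT.
exists (C * v ^+ k); first by rewrite mulr_gt0// exprn_gt0.
move=> s; have [N] := ubnP (size s); elim: N => // N ih in s *.
move=> sN; have [sk|ks] := ltnP (size s) k.
  apply: le_trans (hC s) _; rewrite -mulrA ler_pM2l//.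
  apply: le_trans (_ : (v * t) ^+ size s <= _).
    by rewrite lerXn2r ?nnegrE// ?mulr_ge0// ltW.
  by rewrite exprMn ler_pM2r ?exprn_gt0// ler_weXn2l// ltnW.
rewrite -[s in wordmx A s](cat_take_drop k) wordmx_cat.
rewrite (le_trans (mxnormM _ _))// mulrCA mulrC.
have st : size (take k s) = k by rewrite size_takel.
have -> : t ^+ size s = t ^+ k * t ^+ size (drop k s).
  by rewrite -exprD size_drop subnKC.
rewrite mulrCA; apply: ler_pM; rewrite ?mulr_ge0//; first exact: hk.
apply: ih; rewrite size_drop.
by rewrite (leq_trans _ (sN : (size s <= N)%N))// ltn_subrL k0 (leq_trans k0).
Qed.

Lemma cvg_root (R : realType) (C : R) : 0 < C ->
  (fun k : nat => C `^ k%:R^-1) @ \oo --> (1 : R).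
Proof.
move=> C0; rewrite -[X in _ --> X](powRr0 C).
have h : (fun k : nat => (k%:R : R)^-1) @ \oo --> (0 : R).
  by rewrite -(cvg_shiftS _ ); exact: cvg_harmonic.
rewrite /powR gt_eqF//.
have c : continuous (fun r : R => expR (r * ln C)).
  move=> r; apply: (@continuous_comp _ _ _ (fun r : R => r * ln C) expR).
    exact: mulrr_continuous.
  exact: continuous_expR.
exact: (cvg_comp _ _ h (c 0)).
Qed.

(** A form of Fekete's lemma: the limit exists, with value [rho].  A growth rate
    [t] bounds the [k]-th term by [C ^ (1/k) * t]; in the other direction,
    [growth_rate_of_length] turns the [k]-th term times [n ^ (1/k)] into a
    growth rate, up to an arbitrary excess.  Both factors tend to [1]. *)
Lemma jsr_growth (R : realType) (n m : nat) (A : 'I_m -> 'M[R]_n) :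
  (0 < n)%N -> joint_spectral_radius A = inf (growth_rate A).
Proof.
move=> n_gt0; set rho := inf _.
have ne : growth_rate A !=set0 by have [t ?] := growth_rate_exists A; exists t.
have lb : has_lbound (growth_rate A) by exists 0 => t [/ltW].
have rho0 : 0 <= rho by apply: lb_le_inf => // t [/ltW].
apply/cvg_lim => //.
set u := (X in X @ _ --> _).
have nR : 0 < n%:R :> R by rewrite ltr0n.
have lower k : (0 < k)%N -> rho * (n%:R^-1) `^ k%:R^-1 <= u k.
  move=> k0.
  have kR : (k%:R : R) != 0 by rewrite pnatr_eq0 -lt0n.
  have u0 : 0 <= u k by apply: bigmax_ge_id.
  have root0 : 0 < n%:R `^ k%:R^-1 :> R by apply: powR_gt0.
  have -> : n%:R^-1 `^ k%:R^-1 = (n%:R `^ k%:R^-1)^-1 :> R.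
    apply: (mulIf (lt0r_neq0 root0)); rewrite -powRM ?invr_ge0//.
    by rewrite !mulVf ?powR1 ?gt_eqF.
  rewrite ler_pdivrMr//.
  apply/ler_addgt0Pr => e e0.
  apply: ge_inf => //; apply: (@growth_rate_of_length _ _ _ _ _ k) => //.
    by rewrite ltr_wpDl// mulr_ge0// ltW.
  move=> s sk; pose sg : k.-tuple 'I_m := tcast sk (in_tuple s).
  have us : `|wordmx A s| `^ k%:R^-1 <= u k.
    have -> : wordmx A s = word_product A sg by rewrite word_productE val_tcast.
    exact: (le_bigmax _ (fun sigma : k.-tuple 'I_m =>
      `|word_product A sigma| `^ k%:R^-1)).
  have powK (x : R) : 0 <= x -> x = (x `^ k%:R^-1) ^+ k.
    by move=> x0; rewrite -powR_mulrn ?powR_ge0// -powRrM mulVf// powRr1.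
  have -> : n%:R * `|wordmx A s| =
      (n%:R `^ k%:R^-1 * `|wordmx A s| `^ k%:R^-1) ^+ k.
    by rewrite exprMn -!powK.
  have le_e : n%:R `^ k%:R^-1 * `|wordmx A s| `^ k%:R^-1 <=
      u k * n%:R `^ k%:R^-1 + e.
    by rewrite mulrC ler_wpDr ?(ltW e0)// ler_wpM2r// ltW.
  by rewrite lerXn2r ?nnegrE// ?addr_ge0 ?mulr_ge0 ?powR_ge0// ltW.
have upper t : growth_rate A t -> exists2 C, 0 < C &
    forall k, (0 < k)%N -> u k <= t * C `^ k%:R^-1.
  move=> [t0 [C C0 hC]]; exists C => // k k0.
  have kR : (k%:R : R) != 0 by rewrite pnatr_eq0 -lt0n.
  apply: bigmax_le => [|sg _]; first by rewrite mulr_ge0 ?powR_ge0 ?ltW.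
  have := hC sg; rewrite size_tuple -word_productE => h.
  apply: le_trans (_ : (C * t ^+ k) `^ k%:R^-1 <= _).
    by rewrite ge0_ler_powR ?nnegrE ?invr_ge0// ?mulr_ge0 ?exprn_ge0// ltW.
  have t0' : 0 <= t by apply: ltW.
  rewrite powRM ?(ltW C0) ?exprn_ge0// mulrC ler_wpM2r ?powR_ge0//.
  by rewrite -powR_mulrn// -powRrM mulfV// powRr1.
apply/cvgrPdist_lt => e e0.
have e2 : 0 < e / 2 by rewrite divr_gt0.
have [t [gt /ltW]] : exists t, growth_rate A t /\ t < rho + e / 2.
  have [t gt lt] := inf_adherent e2 (conj ne lb).
  by exists t.
move=> /growth_rate_le/(_ gt) {t gt}/upper[C C0 hC].
have cu : (fun k : nat => (rho + e / 2) * C `^ k%:R^-1) @ \oo --> rho + e / 2.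
  by rewrite -[X in _ --> X]mulr1; apply: cvgMr; exact: cvg_root.
have cl : (fun k : nat => rho * n%:R^-1 `^ k%:R^-1) @ \oo --> rho.
  by rewrite -[X in _ --> X]mulr1; apply: cvgMr; apply: cvg_root;
    rewrite invr_gt0.
have ru : rho + e / 2 < rho + e by lra.
have rl : rho - e < rho by lra.
near=> k.
have k0 : (0 < k)%N by near: k; exists 1%N.
rewrite ltr_distlC; apply/andP; split.
  apply: lt_le_trans (lower k k0).
  by near: k; exact: (cvgr_gt _ cl).
apply: le_lt_trans (hC k k0) _.
by near: k; exact: (cvgr_lt _ cu).
Unshelve. all: by end_near.
Qed.

(** * Feasibility and growth *)

Lemma feasible_decay (R : realType) (n m : nat) (A P : 'I_m -> 'M[R]_n)
    (gamma : R) :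
  (forall i j x, gamma ^+ 2 * qform (P j) (A i *m x) <= qform (P i) x) ->
  forall s i j x,
    (gamma ^+ (size s).+1) ^+ 2 * qform (P j) (wordmx A (i :: s) *m x)
      <= qform (P i) x.
Proof.
move=> step; elim=> [|k s ih] i j x; first by rewrite expr1 wordmx1.
rewrite wordmx_cons -mulmxA.
apply: le_trans (step i k x).
by rewrite [size _]/= (exprS gamma _.+1) exprMn -mulrA ler_wpM2l ?sqr_ge0.
Qed.

(** An entry of a product is a coordinate functional evaluated on the image of
    a basis vector, so [dual_bound] compares its square with the form [P_i],
    which [feasible_decay] controls. *)
Lemma feasible_growth_rate (R : realType) (n m : nat) (A : 'I_m -> 'M[R]_n)
    (gamma : R) :
  0 < gamma -> V2G1_feasible A gamma -> growth_rate A gamma^-1.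
Proof.
move=> g0 [P [pP lP]]; split; first by rewrite invr_gt0.
have step i j x : gamma ^+ 2 * qform (P j) (A i *m x) <= qform (P i) x.
  have := lP i j; rewrite loewner_leE ?sym_congr ?(pP _).1// => /(_ x).
  by rewrite qformZ qform_congr.
pose e l : 'rV[R]_n := delta_mx 0 l.
pose K j l := (e l *m invmx (P j) *m (e l)^T) 0 0.
pose M := \big[Num.max/0]_(q : 'I_m * 'I_n * 'I_n)
  (K q.1.1 q.1.2 * P q.1.1 q.2 q.2).
have M0 : 0 <= M by apply: bigmax_ge_id.
exists (1 + M); first by rewrite ltr_pwDl.
case=> [|i s].
  by rewrite wordmx_nil expr0 mulr1 (le_trans (mxnorm1_le1 _ _))// lerDl.
rewrite [size _]/= exprVn; set k := (size s).+1.
have gk : 0 < gamma ^+ k by apply: exprn_gt0.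
apply: mxnorm_le => [|l c]; first by rewrite divr_ge0 ?addr_ge0// ltW.
rewrite ler_pdivlMr// -ler_sqr ?nnegrE ?mulr_ge0 ?addr_ge0 ?(ltW gk)//.
rewrite exprMn real_normK ?num_real//.
apply: (@le_trans _ _ M); last by nra.
(* [M] dominates the constants of all words at once. *)
apply: le_trans (le_bigmax _ (fun q : 'I_m * 'I_n * 'I_n =>
  K q.1.1 q.1.2 * P q.1.1 q.2 q.2) (i, l, c)).
rewrite /= -qform_delta.
have -> : wordmx A (i :: s) l c =
    (e l *m (wordmx A (i :: s) *m (delta_mx c 0 : 'cV_n))) 0 0.
  by rewrite -rowE -colE !mxE.
have uP := posdef_unit (pP i).
have K0 : 0 <= K i l by apply: dual_form_ge0 => //; exact: posdef_possemidef.
rewrite mulrC.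
apply: le_trans (_ : K i l * qform (P i) (wordmx A (i :: s) *m delta_mx c 0) *
   (gamma ^+ k) ^+ 2 <= _).
  rewrite mulrC ler_wpM2r ?sqr_ge0//.
  by apply: dual_bound => //; exact: posdef_possemidef.
by rewrite -mulrA ler_wpM2l// mulrC; exact: feasible_decay.
Qed.

(** In the proof, the functionals in [F] define the adapted norm, and
    [contract] is the common Lyapunov inequality for products of length two. *)
Lemma growth_rate_feasible (R : realType) (n m : nat) (A : 'I_m -> 'M[R]_n)
    (lam gamma d : R) :
  (0 < n)%N -> 0 < d -> growth_rate A lam ->
  gamma ^+ 4 * (lam ^+ 4 * (n%:R + d)) <= 1 -> V2G1_feasible A gamma.
Proof.
move=> n0 d0 [l0 [C C0 hC]] small.
pose F : set 'rV[R]_n :=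
  [set f | exists s i, f = (lam ^+ size s)^-1 *: row i (wordmx A s)].
have F_delta i : F (delta_mx 0 i).
  by exists [::], i; rewrite wordmx_nil expr0 invr1 scale1r row1.
have F_bounded f i : F f -> `|f 0 i| <= C.
  move=> [s [k ->]]; rewrite entryZ mxE normrM ger0_norm; last first.
    by rewrite invr_ge0 exprn_ge0// ltW.
  rewrite mulrC ler_pdivrMr ?exprn_gt0//.
  exact: le_trans (entry_le_mxnorm _ _ _) (hC s).
have F_shift f j : F f -> exists2 g, F g & f *m A j = lam *: g.
  move=> [s [k ->]].
  exists ((lam ^+ (size s).+1)^-1 *: row k (wordmx A (j :: s))).
    by exists (j :: s), k.
  rewrite scalerA exprS invfM mulrA mulfV ?gt_eqF// mul1r.
  by rewrite wordmx_cons -scalemxAl row_mul.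
have [P [[[sP pP] lP] uP dualP]] := approx_john n0 d0 F_delta F_bounded.
have nd0 : 0 < n%:R + d by rewrite ltr_wpDl.
have F_le f x : F f -> ((f *m x) 0 0) ^+ 2 <= (n%:R + d) * qform P x.
  move=> Ff; apply: le_trans (dual_bound f x (conj sP pP) uP) _.
  by rewrite ler_wpM2r ?dualP//; exact: pP.
have contract i j x : gamma ^+ 4 * qform P (A j *m (A i *m x)) <= qform P x.
  apply: (@le_trans _ _ (gamma ^+ 4 * (lam ^+ 4 * (n%:R + d) * qform P x))).
    apply: ler_wpM2l; first by rewrite exprn_even_ge0.
    apply: lP => f Ff.
    have [g Fg fg] := F_shift f j Ff; have [h Fh gh] := F_shift g i Fg.
    rewrite !mulmxA fg -scalemxAl gh -!scalemxAl !entryZ.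
    rewrite mulrA exprMn -expr2 -exprM -mulrA ler_wpM2l ?F_le//.
    by rewrite exprn_even_ge0.
  by rewrite mulrA ler_piMl//; exact: pP.
have posP : posdefmx P.
  split=> // x x0.
  have [i xi] : exists i, x i 0 != 0.
    apply/existsP; apply: contraNT x0; rewrite negb_exists => /forallP h.
    apply/eqP/matrixP => i j; rewrite ord1 mxE; apply/eqP.
    by have := h i; rewrite negbK.
  have := F_le _ x (F_delta i); rewrite -rowE mxE => h.
  rewrite -(pmulr_rgt0 _ nd0); apply: lt_le_trans h.
  by rewrite exprn_even_gt0.
(* For the forms [P_i] below, the one-step inequality from [i] to [j] is the
   two-step inequality along [i, j] with the term of [A i] added to both
   sides. *)
exists (fun i => P + gamma ^+ 2 *: ((A i)^T *m P *m A i)).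
have symQ i : P + gamma ^+ 2 *: ((A i)^T *m P *m A i) \is symmetricmx.
  have /symmetricmxP sB := sym_congr (gamma ^+ 2) (A i) sP.
  by apply/symmetricmxP; move/symmetricmxP : sP => sP; rewrite linearD/= sB sP.
split=> [i|i j].
  split=> // x x0; rewrite -/(qform _ x) qformD qformZ qform_congr.
  by rewrite ltr_wpDr ?posP.2// mulr_ge0 ?sqr_ge0//; exact: pP.
apply/loewner_leE => //; first exact: sym_congr.
move=> x; rewrite !(qformD, qformZ, qform_congr) mulrDr addrC lerD2r.
by rewrite mulrA -exprD; exact: contract.
Qed.

Theorem theorem5p16 (R : realType) (n m : nat) (n_gt0 : (0 < n)%N)
    (m_gt0 : (0 < m)%N) (A : 'I_m -> 'M[R]_n) :
  (n%:R `^ (4%:R)^-1)^-1 * rhohat_V2G1 A <= joint_spectral_radius A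
  /\ joint_spectral_radius A <= rhohat_V2G1 A.
Proof.
rewrite jsr_growth//; set rho := inf (growth_rate A).
have ne : growth_rate A !=set0 by have [t ?] := growth_rate_exists A; exists t.
have lb : has_lbound (growth_rate A) by exists 0 => t [/ltW].
have rho0 : 0 <= rho by apply: lb_le_inf => // t [/ltW].
set r := n%:R `^ _.
have r0 : 0 < r by rewrite powR_gt0// ltr0n.
have r4 : r ^+ 4 = n%:R.
  by rewrite -powR_mulrn ?powR_ge0// -powRrM mulVf ?powRr1// pnatr_eq0.
set S := [set gamma^-1 | gamma in
  [set gamma : R | 0 < gamma /\ V2G1_feasible A gamma]].
have SP mu : r * rho < mu -> S mu.
  move=> rmu.
  have mu0 : 0 < mu by apply: le_lt_trans rmu; rewrite mulr_ge0// ltW.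
  (* The midpoint leaves room on both sides: above [rho], for a growth rate,
     and below [mu / r], for the loss [d] of [approx_john]. *)
  pose lam := (mu / r + rho) / 2.
  have rho_lt : rho < mu / r by rewrite ltr_pdivlMr// mulrC.
  have lam_rho : rho < lam by rewrite /lam; lra.
  have lam0 : 0 < lam by apply: le_lt_trans lam_rho.
  have lam_mu : r * lam < mu.
    by rewrite mulrC -ltr_pdivlMr// /lam; lra.
  have d0 : 0 < (mu / lam) ^+ 4 - n%:R.
    rewrite subr_gt0 -r4 ltrXn2r ?nnegrE ?divr_ge0 ?(ltW r0) ?(ltW mu0)
      ?(ltW lam0)//.
    by rewrite ltr_pdivlMr.
  exists mu^-1; last by rewrite invrK.
  split; first by rewrite invr_gt0.
  apply: (growth_rate_feasible n_gt0 d0 (lam := lam)).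
    have [t gt tlam] := inf_lt ne lam_rho.
    exact: growth_rate_le (ltW tlam) gt.
  rewrite addrC subrK -!exprMn.
  have -> : mu^-1 * (lam * (mu / lam)) = 1 by field; rewrite !gt_eqF.
  by rewrite expr1n.
have lbS : lbound S rho.
  move=> _ [gamma [g0 feas] <-]; apply: ge_inf => //.
  exact: feasible_growth_rate.
split; last first.
  apply: lb_le_inf lbS; exists (r * rho + 1); apply: SP; lra.
rewrite mulrC ler_pdivrMr// mulrC; apply/ler_addgt0Pr => e e0.
by apply: ge_inf; [exists rho|apply: SP; rewrite ltrDl].
Qed.
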